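(* Let $\{\mathbb{S}_n\}_{n\geqslant0}$ be the monic orthogonal polynomial system associated with an $xy$-symmetric weight function $W$ on $\Omega\subset\mathbb{R}^2$, with three term relation coefficients $\Gamma_{n,k}$, and let $\{\widehat{\mathbb{P}}_n^{(i,j)}\}_{n\geqslant0}$, $i,j\in\{0,1\}$, be the four associated small monic orthogonal polynomial systems. For $k=1,2$ let \begin{align*} \widehat{\Gamma}_{n,k}^{(0,0)}&=\mathrm{J}_n^{(0,0)}\,\Gamma_{2n,k}\,(\mathrm{J}_{n-1}^{(2-k,k-1)})^\top\ (n\geqslant1), & \widehat{\Gamma}_{n,k}^{(0,1)}&=\mathrm{J}_{n-1}^{(1,1)}\,\Gamma_{2n,k}\,(\mathrm{J}_{n-1}^{(k-1,2-k)})^\top\ (n\geqslant1),\\ \widehat{\Gamma}_{n,k}^{(1,1)}&=\mathrm{J}_n^{(k-1,2-k)}\,\Gamma_{2n+1,k}\,(\mathrm{J}_{n-1}^{(1,1)})^\top\ (n\geqslant1), & \widehat{\Gamma}_{n,k}^{(1,0)}&=\mathrm{J}_n^{(2-k,k-1)}\,\Gamma_{2n+1,k}\,(\mathrm{J}_n^{(0,0)})^\top\ (n\geqslant0), \end{align*} and define the semi-infinite block bidiagonal matrices (blank blocks are zero, $I$ denotes identity matrices of sizes $1,2,3,\dots$) $$\mathsf{L}^0_k=\begin{bmatrix} I\\ \widehat\Gamma^{(0,0)}_{1,k}&I\\ &\widehat\Gamma^{(0,0)}_{2,k}&I\\ &&\ddots&\ddots\end{bmatrix},\qquad \mathsf{L}^1_k=\begin{bmatrix}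 I\\ \widehat\Gamma^{(1,1)}_{1,k}&I\\ &\widehat\Gamma^{(1,1)}_{2,k}&I\\ &&\ddots&\ddots\end{bmatrix},$$ $$\mathsf{U}^0_k=\begin{bmatrix}\widehat\Gamma^{(0,1)}_{1,k}&\mathrm{L}_{0,k}\\&\widehat\Gamma^{(0,1)}_{2,k}&\mathrm{L}_{1,k}\\&&\ddots&\ddots\end{bmatrix},\qquad \mathsf{U}^1_k=\begin{bmatrix}\widehat\Gamma^{(1,0)}_{0,k}&\mathrm{L}_{0,k}\\&\widehat\Gamma^{(1,0)}_{1,k}&\mathrm{L}_{1,k}\\&&\ddots&\ddots\end{bmatrix}.$$ For $i,j\in\{0,1\}$ let $\mathcal{P}^{(i,j)}=\begin{bmatrix}(\widehat{\mathbb{P}}_0^{(i,j)})^\top&(\widehat{\mathbb{P}}_1^{(i,j)})^\top&\cdots\end{bmatrix}^\top$. Then, for $k=1,2$ with $x_1=x$, $x_2=y$, \begin{align*} x_k\,\mathcal{P}^{(0,0)}&=x_k\,\mathsf{L}^0_k\,\mathcal{P}^{(2-k,k-1)}=\mathsf{L}^0_k\,\mathsf{U}^1_k\,\mathcal{P}^{(0,0)},\\ x_k\,\mathcal{P}^{(1,1)}&=\mathsf{U}^0_k\,\mathcal{P}^{(k-1,2-k)}=\mathsf{U}^0_k\,\mathsf{L}^1_k\,\mathcal{P}^{(1,1)},\\ x_k\,\mathcal{P}^{(2-k,k-1)}&=\mathsf{U}^1_k\,\mathcal{P}^{(0,0)}=\mathsf{U}^1_k\,\mathsf{L}^0_k\,\mathcal{P}^{(2-k,k-1)},\\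 x_k\,\mathcal{P}^{(k-1,2-k)}&=x_k\,\mathsf{L}^1_k\,\mathcal{P}^{(1,1)}=\mathsf{L}^1_k\,\mathsf{U}^0_k\,\mathcal{P}^{(k-1,2-k)}. \end{align*}
   Context: Weight function on $\Omega\subset\mathbb{R}^2$: a nonnegative function $W$ on $\Omega$ with positive integral and all moments finite (defined up to null sets). It is $xy$-symmetric if $(x,y)\in\Omega$ implies $(-x,y),(x,-y)\in\Omega$, and $W(-x,y)=W(x,y)=W(x,-y)$ on $\Omega$. The monic orthogonal polynomial system (MOPS) associated with $W$ on $\Omega$ is the unique sequence of column vectors $\mathbb{P}_n=[P_{n,0},\dots,P_{n,n}]^\top$, $n\geqslant0$, of real bivariate polynomials with $P_{n,j}(x,y)=x^{n-j}y^j+(\text{polynomial of total degree}\leqslant n-1)$ and $\int_\Omega\mathbb{P}_n\mathbb{P}_m^\top W\,dx\,dy=0$ for $n\ne m$ (for $n=m$ this matrix is symmetric positive-definite). $\mathrm{L}_{n,1}=[\,I_{n+1}\mid 0\,]$ and $\mathrm{L}_{n,2}=[\,0\mid I_{n+1}\,]$ are $(n+1)\times(n+2)$ matrices. $\mathrm{J}_n^{(i,j)}$, $i,j\in\{0,1\}$, is the $(n+1)\times(2n+1+i+j)$ matrix whose entry (rows and columns indexed from $0$) in position $(h,2h+j)$ is $1$ for $0\leqslant h\leqslant n$, all other entries being $0$. Since $W$ is $xy$-symmetric, its MOPS satisfies $x_k\mathbb{S}_n=\mathrm{L}_{n,k}\mathbb{S}_{n+1}+\Gamma_{n,k}\mathbb{S}_{n-1}$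 for $n\geqslant0$, $k=1,2$, with $\mathbb{S}_{-1}=0$ and, for $n\geqslant1$, $\Gamma_{n,k}=\mathbf{S}_n\mathrm{L}_{n-1,k}^\top\mathbf{S}_{n-1}^{-1}$ of size $(n+1)\times n$, where $\mathbf{S}_n=\int_\Omega\mathbb{S}_n\mathbb{S}_n^\top W\,dx\,dy$. Small systems: each entry $S_{n,k}$ of $\mathbb{S}_n$ contains only powers of $x$ of the parity of $n-k$ and only powers of $y$ of the parity of $k$. The vectors $\widehat{\mathbb{P}}_n^{(i,j)}$ (size $n+1$) are defined as follows: for $0\leqslant h\leqslant n$, the $h$-th entry (from $0$) of $\widehat{\mathbb{P}}_n^{(0,0)}(x^2,y^2)$ is $S_{2n,2h}(x,y)$, of $xy\,\widehat{\mathbb{P}}_n^{(1,1)}(x^2,y^2)$ is $S_{2n+2,2h+1}(x,y)$, of $x\,\widehat{\mathbb{P}}_n^{(1,0)}(x^2,y^2)$ is $S_{2n+1,2h}(x,y)$, and of $y\,\widehat{\mathbb{P}}_n^{(0,1)}(x^2,y^2)$ is $S_{2n+1,2h+1}(x,y)$. $\{\widehat{\mathbb{P}}_n^{(i,j)}\}$ is the MOPS for $W^{(i,j)}(x,y)=\frac14x^iy^j\frac{1}{\sqrt{xy}}W(\sqrt x,\sqrt y)$ on $\{(x,y):x,y\geqslant0,(\sqrt x,\sqrt y)\in\Omega\}$. *)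

(* Defs.v *)
From HB Require Import structures.
From mathcomp Require Import all_boot all_order all_algebra.
From mathcomp Require Import all_classical all_reals all_analysis.

Set Implicit Arguments.
Unset Strict Implicit.
Unset Printing Implicit Defensive.

Import Order.TTheory GRing.Theory Num.Theory.
Import numFieldNormedType.Exports.

Local Open Scope classical_set_scope.
Local Open Scope ring_scope.

(* Real bivariate polynomials are elements of {poly {poly R}}, with the
   conventions of polyXY: 'X stands for x, 'Y = 'X%:P for y, p`_a`_b is the
   coefficient of x^a y^b, and p.[x, y] is the value of p at (x, y). *)

Section WeightFunctions.
Variable R : realType.

Definition plane : Type := (measurableTypeR R * measurableTypeR R)%type.

Definition leb2 := (@lebesgue_measure R \x @lebesgue_measure R)%E.

(* The conditions on the values of W are required almost everywhere, since
   weight functions are considered up to null sets. *)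
Definition weight_function (Omega : set plane) (W : plane -> R) : Prop :=
  [/\ measurable Omega,
      measurable_fun Omega W,
      {ae leb2, forall z, Omega z -> 0 <= W z},
      0 < \int[leb2]_(z in Omega) W z
    & forall a b : nat,
        leb2.-integrable Omega
          (fun z => ((z.1 : R) ^+ a * (z.2 : R) ^+ b * W z)%:E)].

Definition xy_symmetric (Omega : set plane) (W : plane -> R) : Prop :=
  (forall x y : R, Omega (x, y) -> Omega (- x, y) /\ Omega (x, - y)) /\
  {ae leb2, forall z, Omega z ->
     W (- (z.1 : R), z.2) = W z /\ W z = W (z.1, - (z.2 : R))}.

(* Column vectors of polynomials of sizes 1, 2, 3, ...; the vector with index
   n has size n.+1. Stacking the vectors, this is also a semi-infinite block
   column vector. *)
Definition polysystem := forall n : nat, 'cV[{poly {poly R}}]_n.+1.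

Definition total_degree_lt (d : nat) (p : {poly {poly R}}) : Prop :=
  forall a b : nat, (d <= a + b)%N -> p`_a`_b = 0.

(* The matrix \int_Omega P_n P_m^T W dx dy. *)
Definition moment_matrix (Omega : set plane) (W : plane -> R)
    (P : polysystem) (n m : nat) : 'M[R]_(n.+1, m.+1) :=
  \matrix_(i, j) \int[leb2]_(z in Omega)
     ((P n i ord0).[z.1, z.2] * (P m j ord0).[z.1, z.2] * W z).

Definition MOPS (Omega : set plane) (W : plane -> R) (P : polysystem) : Prop :=
  (forall (n : nat) (j : 'I_n.+1),
     exists2 q : {poly {poly R}}, total_degree_lt n q &
       P n j ord0 = 'X^(n - j) * 'Y ^+ j + q) /\
  (forall n m : nat, n != m -> moment_matrix Omega W P n m = 0).

(* Entry h of x^i y^j P_n^(i,j)(x^2, y^2) is S_(2n+i+j, 2h+j); this is the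
   uniform rendering of the four cases i, j in {0, 1}. *)
Definition small_systems (S : polysystem) (P : nat -> nat -> polysystem) :
    Prop :=
  forall i j n : nat, (i <= 1)%N -> (j <= 1)%N ->
  forall (h : 'I_n.+1) (x y : R),
    x ^+ i * y ^+ j * (P i j n h ord0).[x ^+ 2, y ^+ 2] =
    (S (n.*2 + i + j)%N (inord (h.*2 + j)) ord0).[x, y].

End WeightFunctions.

Section ThreeTerm.
Variable R : realType.

(* [I | 0] for k = 1 and [0 | I] for k = 2. *)
Definition Lmx (n k : nat) : 'M[R]_(n.+1, n.+2) :=
  \matrix_(i, j) (j == i + (k - 1) :> nat)%N%:R.

(* The column count is written with i + j in front so that it reduces for
   numeral i and j. *)
Definition Jmx (n i j : nat) : 'M[R]_(n.+1, i + j + n.*2.+1) :=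
  \matrix_(h, c) (c == h.*2 + j :> nat)%N%:R.

(* J_n^(2-k,k-1) and J_n^(k-1,2-k), which have 2n+2 columns for k = 1, 2;
   conform_mx then only casts along the equality of the column counts. *)
Definition Jk (n k : nat) : 'M[R]_(n.+1, n.*2.+2) :=
  conform_mx 0 (Jmx n (2 - k) (k - 1)).

Definition Jk' (n k : nat) : 'M[R]_(n.+1, n.*2.+2) :=
  conform_mx 0 (Jmx n (k - 1) (2 - k)).

(* The value at n = 0 is the empty matrix. *)
Definition Gamma (Omega : set (plane R)) (W : plane R -> R)
    (S : polysystem R) (n k : nat) : 'M[R]_(n.+1, n) :=
  match n with
  | 0 => 0
  | m.+1 => moment_matrix Omega W S m.+1 m.+1 *m (Lmx m k)^T
              *m invmx (moment_matrix Omega W S m m)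
  end.

Section SmallGamma.
Variable G : forall n : nat, nat -> 'M[R]_(n.+1, n).

(* In the first three definitions, whose matrices are indexed from 1, the
   value at n is the matrix with index n + 1. *)
Definition Gamma00 (k n : nat) : 'M[R]_(n.+2, n.+1) :=
  Jmx n.+1 0 0 *m G n.+1.*2 k *m (Jk n k)^T.

Definition Gamma01 (k n : nat) : 'M[R]_(n.+1, n.+1) :=
  Jmx n 1 1 *m G n.+1.*2 k *m (Jk' n k)^T.

Definition Gamma11 (k n : nat) : 'M[R]_(n.+2, n.+1) :=
  Jk' n.+1 k *m G n.+1.*2.+1 k *m (Jmx n 1 1)^T.

Definition Gamma10 (k n : nat) : 'M[R]_(n.+1, n.+1) :=
  Jk n k *m G n.*2.+1 k *m (Jmx n 0 0)^T.

End SmallGamma.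
End ThreeTerm.

Section BlockMatrices.
Variable R : realType.

(* Semi-infinite block matrices: block (m, n) has size m.+1 x n.+1. *)
Definition blockmx := forall m n : nat, 'M[R]_(m.+1, n.+1).

(* In the block rows below all but finitely many blocks vanish, so that the
   sums over nat are the finitely supported sums of fsbigop. *)
Definition bmul (A B : blockmx) : blockmx :=
  fun m p => \sum_(n \in [set: nat]) (A m n *m B n p).

Definition bmulv (A : blockmx) (v : polysystem R) : polysystem R :=
  fun m => \sum_(n \in [set: nat])
             (map_mx (fun c : R => c%:P%:P) (A m n) *m v n).

Definition bscale (c : {poly {poly R}}) (v : polysystem R) : polysystem R :=
  fun n => c *: v n.

(* Identity blocks on the diagonal, D n in position (n.+1, n). The blocks are
   only placed where their size is the right one, where conform_mx is a cast. *)
Definition block_lower (D : forall n : nat, 'M[R]_(n.+2, n.+1)) : blockmx :=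
  fun m n => if m == n then conform_mx 0 (1%:M : 'M[R]_n.+1)
             else if m == n.+1 then conform_mx 0 (D n) else 0.

(* D n in position (n, n), E n in position (n, n.+1). *)
Definition block_upper (D : forall n : nat, 'M[R]_(n.+1, n.+1))
    (E : forall n : nat, 'M[R]_(n.+1, n.+2)) : blockmx :=
  fun m n => if n == m then conform_mx 0 (D m)
             else if n == m.+1 then conform_mx 0 (E m) else 0.

Variable G : forall n : nat, nat -> 'M[R]_(n.+1, n).

Definition L0 (k : nat) : blockmx := block_lower (Gamma00 G k).
Definition L1 (k : nat) : blockmx := block_lower (Gamma11 G k).
Definition U0 (k : nat) : blockmx :=
  block_upper (Gamma01 G k) (fun n => Lmx R n k).
Definition U1 (k : nat) : blockmx :=
  block_upper (Gamma10 G k) (fun n => Lmx R n k).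

(* x_1 = x and x_2 = y. *)
Definition xvar (k : nat) : {poly {poly R}} := if k == 1%N then 'X else 'Y.

End BlockMatrices.

(* Main.v *)
Require Import Defs.
From HB Require Import structures.
From mathcomp Require Import all_boot all_order all_algebra.
From mathcomp Require Import all_classical all_reals all_analysis.
From mathcomp Require Import measurable_realfun zify ring.

Set Implicit Arguments.
Unset Strict Implicit.
Unset Printing Implicit Defensive.

Import Order.TTheory GRing.Theory Num.Theory.

(** Each entry S_(n,l) is x^i y^j times a polynomial in (x^2, y^2), with i and
    j the parities of n - l and l. Hence x_k S_(n+1,j) - S_(n+2,j+k-1) has
    degree at most n, and comparing its products with S_0, ..., S_n gives the
    three term relation, in which the coefficients Gamma_(j,l) with l of the
    wrong parity vanish. Dividing the relation for S_(n,j) by the common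
    monomial and substituting x for x^2 and y for y^2 leaves, for the four
    parity classes of (n, j), the four relations between small systems; these
    are the rows of the bidiagonal systems, and the products of bidiagonal
    matrices follow by associativity. The Gram matrices are invertible because
    a nonzero polynomial vanishes only on a null set. *)

(** * Bivariate polynomials as functions: roots and extensionality *)

Section BivariatePolynomials.
Local Open Scope ring_scope.
Variable R : realType.
Implicit Types p q : {poly {poly R}}.

Lemma poly2_ind (Q : {poly {poly R}} -> Prop) :
  Q 0 -> (forall p q, Q p -> Q q -> Q (p + q)) ->
  (forall (c : R) a b, Q ((c%:P * 'X^b)%:P * 'X^a)) -> forall p, Q p.
Proof.
move=> Q0 QD Qm p; rewrite -(coefK p) poly_def; apply: (big_ind Q) => // a _.
rewrite -mul_polyC -{1}(coefK p`_a) poly_def rmorph_sum mulr_suml.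
apply: (big_ind Q) => // b _.
by rewrite -mul_polyC; apply: Qm.
Qed.

Lemma horner2_monomial (c : R) a b x y :
  ((c%:P * 'X^b)%:P * 'X^a).[x, y] = c * y ^+ b * x ^+ a.
Proof. by rewrite !hornerE. Qed.

Lemma horner2D p q x y : (p + q).[x, y] = p.[x, y] + q.[x, y] :> R.
Proof. by rewrite !hornerE. Qed.

Lemma horner2M p q x y : (p * q).[x, y] = p.[x, y] * q.[x, y] :> R.
Proof. by rewrite !hornerE. Qed.

Lemma horner2C c x y : (c%:P%:P).[x, y] = c :> R.
Proof. by rewrite !hornerE. Qed.

Lemma finite_roots (F : idomainType) (p : {poly F}) :
  p != 0 -> finite_set [set x | root p x].
Proof.
move=> p0; apply: contrapT => inf.
have [s [us ss sp]] : exists s : seq F,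
    [/\ uniq s, size s = size p & all (root p) s].
  have [B BA /= cB] := infinite_set_fset (size p) inf.
  exists (take (size p) (finmap.enum_fset B)).
  split; [by rewrite take_uniq ?finmap.fset_uniq| |].
    exact: size_takel.
  by apply/allP => x /mem_take xB; apply: BA.
by have := max_poly_roots p0 sp us; rewrite ss ltnn.
Qed.

Lemma poly_eq0_inj (F : idomainType) (f : nat -> F) (p : {poly F}) :
  injective f -> (forall i, p.[f i] = 0) -> p = 0.
Proof.
move=> fI pf0; apply/eqP/negPn/negP => p0.
have := @max_poly_roots _ _ [seq f i | i <- iota 0 (size p)] p0.
rewrite size_map size_iota ltnn map_inj_uniq// iota_uniq => H.
suff: false by []; apply: H => //.
by apply/allP => _ /mapP[i _ ->]; apply/eqP.
Qed.

(** For each natural number i, the difference at x = i is a polynomial in y that vanishes at all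
    natural numbers, hence is zero. The difference therefore has infinitely many constant roots in
    [{poly R}]. *)
Lemma poly2_ext p q : (forall x y, p.[x, y] = q.[x, y] :> R) -> p = q.
Proof.
have natI : injective (fun i => i%:R : R).
  by move=> i j /eqP; rewrite eqr_nat => /eqP.
move=> pq; apply/eqP; rewrite -subr_eq0; apply/eqP.
apply: (poly_eq0_inj (f := fun i => (i%:R : R)%:P)) => [i j /polyC_inj/natI//|i].
by apply: (poly_eq0_inj natI) => j; rewrite !hornerE pq subrr.
Qed.

End BivariatePolynomials.

(** * Integration against the weight and definiteness of the moment functional *)

Section WeightedIntegral.
Local Open Scope classical_set_scope.
Local Open Scope ring_scope.
Variables (R : realType) (Omega : set (plane R)) (W : plane R -> R).
Hypothesis hW : weight_function Omega W.
Implicit Types p q : {poly {poly R}}.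

Definition moment p : R :=
  \int[@leb2 R]_(z in Omega) (p.[z.1, z.2] * W z).

Lemma measurable_horner2 p (D : set (plane R)) :
  measurable_fun D (fun z : plane R => p.[z.1, z.2] : R).
Proof.
elim/poly2_ind: p => [|p q mp mq|c a b].
- by under eq_fun do rewrite !hornerE; exact: measurable_cst.
- by under eq_fun do rewrite horner2D; exact: measurable_funD.
- under eq_fun do rewrite horner2_monomial.
  apply: measurable_funM; last first.
    by apply: measurable_funX; apply: measurable_funTS; exact: measurable_fst.
  apply: measurable_funM; first exact: measurable_cst.
  by apply: measurable_funX; apply: measurable_funTS; exact: measurable_snd.
Qed.

Lemma integrable_horner2 p :
  (@leb2 R).-integrable Omega (fun z => (p.[z.1, z.2] * W z)%:E).
Proof.
have [mO mW _ _ iW] := hW.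
elim/poly2_ind: p => [|p q ip iq|c a b].
- under eq_fun do rewrite !horner0 mul0r; exact: integrable0.
- under eq_fun do rewrite horner2D mulrDl EFinD; exact: integrableD.
- under eq_fun do rewrite horner2_monomial -[c * _ * _]mulrA
    [_ ^+ b * _]mulrC -mulrA EFinM.
  exact: integrableZl (iW a b).
Qed.

Lemma momentD p q : moment (p + q) = moment p + moment q.
Proof.
have [mO _ _ _ _] := hW.
rewrite /moment; under eq_Rintegral do rewrite horner2D mulrDl.
by rewrite RintegralD//; exact: integrable_horner2.
Qed.

Lemma momentZ (c : R) p : moment (c%:P%:P * p) = c * moment p.
Proof.
have [mO _ _ _ _] := hW.
rewrite /moment; under eq_Rintegral do rewrite horner2M horner2C -mulrA.
by rewrite RintegralZl//; exact: integrable_horner2.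
Qed.

(** The product measure integrates the lengths of the sections at fixed x. Such a section is the
    root set of [p.[x%:P]], which is finite unless this polynomial in y is zero; that happens only
    when [x%:P] is one of the finitely many roots of [p]. *)
Lemma leb2_zeros p : p != 0 ->
  (@leb2 R).-negligible [set z : plane R | p.[z.1, z.2] = 0].
Proof.
move=> p0; have mZ : measurable [set z : plane R | p.[z.1, z.2] = 0].
  rewrite -[X in measurable X]setTI.
  exact: (measurable_horner2 p (D := setT)) measurableT _ (measurable_set1 0).
apply/negligibleP => //.
have xs (x : R) : p.[x%:P] != 0 ->
    lebesgue_measure (xsection [set z : plane R | p.[z.1, z.2] = 0] x) = 0%E.
  move=> px; apply: countable_lebesgue_measure0; apply: finite_set_countable.
  apply: sub_finite_set (finite_roots px) => y.
  by rewrite xsectionE /= => ?; apply/eqP.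
have fin : finite_set [set x : R | p.[x%:P] = 0].
  apply: sub_finite_set (_ : finite_set (@polyC R @^-1` [set q | root p q])).
    by move=> x /= /eqP.
  apply: finite_preimage (finite_roots p0).
  by move=> x y _ _; apply: polyC_inj.
have mxs : measurable_fun [set: measurableTypeR R]
    (fun x => lebesgue_measure (xsection [set z : plane R | p.[z.1, z.2] = 0] x)).
  exact: measurable_fun_xsection.
rewrite /leb2 /= /product_measure1 (ae_eq_integral (cst 0%E)) ?integral0//.
exists [set x : R | p.[x%:P] = 0]; split.
- apply: countable_measurable; first by move=> ?; exact: measurable_set1.
  exact: finite_set_countable.
- exact/countable_lebesgue_measure0/finite_set_countable.
- move=> x /= H; apply: contrapT => /eqP/xs px; apply: H => _; exact: px.
Qed.

(** Since p^2 W is nonnegative, a zero integral makes it vanish almost everywhere on [Omega]. For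
    nonzero [p] the weight would then vanish there almost everywhere, against its positive
    integral. *)
Lemma moment_sqr_eq0 p : moment (p * p) = 0 -> p = 0.
Proof.
have [mO mW W0 Wpos _] := hW.
move=> I0; apply/eqP/negPn/negP => p0.
have i2 := integrable_horner2 (p * p).
have m2 := measurable_int _ i2.
have /(ae_eq_integral_abs _ mO m2) ae0 :
    (\int[@leb2 R]_(z in Omega) `|((p * p).[z.1, z.2] * W z)%:E| = 0)%E.
  rewrite (ae_eq_integral (fun z : plane R => ((p * p).[z.1, z.2] * W z)%:E))//.
  - by rewrite -[LHS]fineK ?integrable_fin_num//; congr EFin.
  - exact: measurableT_comp.
  - apply: filterS W0 => z Wz /Wz ?.
    by rewrite abse_EFin ger0_norm// mulr_ge0// horner2M -expr2 sqr_ge0.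
have: \int[@leb2 R]_(z in Omega) W z = 0.
  rewrite /Rintegral (ae_eq_integral (cst 0%E)) ?integral0//.
    exact/measurable_EFinP.
  have Z := leb2_zeros p0.
  have {}Z : {ae @leb2 R, forall z : plane R, p.[z.1, z.2] <> 0}.
    by apply: negligibleS Z => z /=; apply: contrapT.
  apply: filterS2 Z ae0 => z pz Wz /Wz /= [].
  rewrite horner2M => /eqP; rewrite !mulf_eq0 !orbb.
  by move=> /orP[/eqP//|/eqP ->].
by move=> W00; rewrite W00 ltxx in Wpos.
Qed.

End WeightedIntegral.

(** * Coefficients and total degree *)

Section Coefficients.
Local Open Scope ring_scope.
Variable R : realType.
Implicit Types p q : {poly {poly R}}.

Lemma poly2P p q : (forall a b, p`_a`_b = q`_a`_b) -> p = q.
Proof. by move=> pq; apply/polyP => a; apply/polyP => b. Qed.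

Lemma coef2D p q a b : (p + q)`_a`_b = p`_a`_b + q`_a`_b.
Proof. by rewrite !coefD. Qed.

Lemma coef2B p q a b : (p - q)`_a`_b = p`_a`_b - q`_a`_b.
Proof. by rewrite !coefB. Qed.

Lemma coef2Z (c : R) p a b : (c%:P%:P * p)`_a`_b = c * p`_a`_b.
Proof. by rewrite !coefCM. Qed.

Lemma coef2_sum (I : finType) (F : I -> {poly {poly R}}) a b :
  (\sum_i F i)`_a`_b = \sum_i (F i)`_a`_b.
Proof. by rewrite !coef_sum. Qed.

Lemma coef2_monomial m l a b :
  ('X^m * 'Y ^+ l : {poly {poly R}})`_a`_b = ((a == m) && (b == l))%:R.
Proof.
rewrite -rmorphXn coefMC coefXn; case: eqP => _; last by rewrite mul0r coef0.
by rewrite mul1r coefXn.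
Qed.

(** The variable x_k is the monomial x^(2-k) y^(k-1); these exponents treat both variables at
    once. *)
Lemma coef2_xvarM k p a b : (1 <= k <= 2)%N ->
  (xvar R k * p)`_a`_b =
    if (2 - k <= a)%N && (k - 1 <= b)%N
    then p`_(a - (2 - k))`_(b - (k - 1)) else 0.
Proof.
case: k => [|[|[|k]]]//= _; rewrite /xvar /=.
  rewrite coefXM subn0 subn1; case: a => [|a] /=; first by rewrite coef0.
  by rewrite subn1.
rewrite coefCM coefXM subn0; case: b => [|b] //=.
by rewrite [(2 - 1)%N]subn1 subn1.
Qed.

Lemma total_degree_ltS d p : total_degree_lt d p -> total_degree_lt d.+1 p.
Proof. by move=> pd a b dab; apply: pd; exact: ltnW. Qed.

Lemma total_degree_ltB d p q :
  total_degree_lt d p -> total_degree_lt d q -> total_degree_lt d (p - q).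
Proof. by move=> pd qd a b dab; rewrite coef2B pd// qd// subrr. Qed.

Lemma total_degree_lt_xvarM k d p : (1 <= k <= 2)%N ->
  total_degree_lt d p -> total_degree_lt d.+1 (xvar R k * p).
Proof.
move=> hk pd a b dab; rewrite coef2_xvarM//; case: ifP => // ?.
by apply: pd; lia.
Qed.

End Coefficients.

(** * Three term relation for a monic system orthogonal under a definite linear functional *)

Section ThreeTermRelation.
Local Open Scope ring_scope.
Variables (R : realType) (L : {poly {poly R}} -> R) (S : polysystem R).
Hypothesis LD : forall p q, L (p + q) = L p + L q.
Hypothesis LZ : forall (c : R) p, L (c%:P%:P * p) = c * L p.
Hypothesis L_sqr_eq0 : forall p, L (p * p) = 0 -> p = 0.
Hypothesis S_monic : forall (n : nat) (j : 'I_n.+1),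
  exists2 q : {poly {poly R}}, total_degree_lt n q &
    S n j ord0 = 'X^(n - j) * 'Y ^+ j + q.
Hypothesis S_orth : forall (n m : nat) (i : 'I_n.+1) (j : 'I_m.+1),
  n != m -> L (S n i ord0 * S m j ord0) = 0.

(* For [l > n], [inord] makes this the entry of index 0. *)
Definition entry n l : {poly {poly R}} := S n (inord l) ord0.

Hypothesis S_parity : forall n l a b, (l <= n)%N ->
  (entry n l)`_a`_b != 0 -> odd b = odd l /\ odd (a + b) = odd n.

Lemma entry_top n l a b : (l <= n)%N -> (n <= a + b)%N ->
  (entry n l)`_a`_b = ((a == n - l)%N && (b == l))%:R.
Proof.
move=> ln nab; rewrite /entry; have [q qn ->] := S_monic (inord l : 'I_n.+1).
by rewrite coef2D coef2_monomial qn// addr0 inordK.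
Qed.

Lemma total_degree_lt_entry n l : (l <= n)%N -> total_degree_lt n.+1 (entry n l).
Proof.
move=> ln a b nab; rewrite entry_top; [|lia..].
by rewrite (_ : _ && _ = false)//; lia.
Qed.

(** In degree at least n only the leading monomials x^(n-l) y^l survive, a different one for each l,
    so the weights of a combination can be read off. *)
Lemma coef2_combination n (c : 'I_n.+1 -> R) a b : (n <= a + b)%N ->
  (\sum_l (c l)%:P%:P * entry n l)`_a`_b =
  if (a + b == n)%N then c (inord b) else 0.
Proof.
move=> nab; rewrite coef2_sum.
under eq_bigr => l _ do rewrite coef2Z entry_top ?leq_ord//.
case: eqP => abn; last first.
  rewrite big1// => l _; have ln := ltn_ord l.
  by rewrite (_ : _ && _ = false) ?mulr0//; lia.
have bn : (b < n.+1)%N by lia.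
rewrite (bigD1 (inord b))//= big1 ?addr0 => [|l]; rewrite ?inordK//.
  by rewrite eqxx (_ : a == _) ?mulr1//; lia.
move=> lb; rewrite [b == l]eq_sym -(inj_eq val_inj) /= inordK// in lb *.
by rewrite (negbTE lb) andbF mulr0.
Qed.

(** The entries of index below n span the polynomials of degree below n: subtracting the combination
    of entries of the highest index that has the top coefficients of [p] lowers the degree. *)
Lemma span_ind (Q : {poly {poly R}} -> Prop) n :
  Q 0 -> (forall p q, Q p -> Q q -> Q (p + q)) ->
  (forall (c : R) p, Q p -> Q (c%:P%:P * p)) ->
  (forall m l, (m < n)%N -> (l <= m)%N -> Q (entry m l)) ->
  forall p, total_degree_lt n p -> Q p.
Proof.
move=> Q0 QD QZ; elim: n => [|n IH] Qe p pn.
  by rewrite (_ : p = 0)//; apply: poly2P => a b; rewrite pn// !coef0.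
rewrite -(subrK (\sum_(l < n.+1) (p`_(n - l)`_l)%:P%:P * entry n l) p).
apply: (QD); last first.
  by apply: (big_ind Q) => // l _; apply/QZ/Qe => //; rewrite leq_ord.
apply: IH => [m l mn lm|a b nab]; first by apply: Qe => //; exact: ltnW.
rewrite coef2B (coef2_combination (fun l : 'I_n.+1 => p`_(n - l)`_l))//.
case: eqP => abn; last by rewrite pn ?subrr//; lia.
by rewrite inordK -?abn ?addnK ?subrr// ltnS leq_addl.
Qed.

Let L0 : L 0 = 0.
Proof. by have := LZ 0 0; rewrite mulr0 mul0r. Qed.

Let LB p q : L (p - q) = L p - L q.
Proof. by rewrite -mulN1r -!polyCN LD LZ mulN1r. Qed.

Let LsumZ (I : finType) (c : I -> R) (F : I -> {poly {poly R}}) :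
  L (\sum_i (c i)%:P%:P * F i) = \sum_i c i * L (F i).
Proof.
rewrite (big_morph L LD L0); by apply: eq_bigr => i _.
Qed.

Lemma orth_low_degree n l p : total_degree_lt n p -> L (entry n l * p) = 0.
Proof.
move: p; apply: span_ind => [|p q hp hq|c p hp|m j mn jm].
- by rewrite mulr0.
- by rewrite mulrDr LD hp hq addr0.
- by rewrite mulrCA LZ hp mulr0.
- by apply: S_orth; rewrite gtn_eqF.
Qed.

Definition gram n : 'M[R]_n.+1 := \matrix_(i, j) L (S n i ord0 * S n j ord0).

Lemma gramE n i j : gram n i j = L (entry n i * entry n j).
Proof. by rewrite mxE /entry !inord_val. Qed.

(** If v annihilates the Gram matrix, L vanishes on the square of the combination of the [entry n l]
    with weights v. The combination is then zero, and so are its top coefficients, which are the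
    entries of v. *)
Lemma gram_unit n : gram n \in unitmx.
Proof.
rewrite -row_free_unit; apply: inj_row_free => v vG.
have e0 : \sum_l (v 0 l)%:P%:P * entry n l = 0.
  apply: L_sqr_eq0.
  rewrite mulr_suml.
  under eq_bigr do rewrite -mulrA; rewrite LsumZ big1// => i _.
  rewrite mulr_sumr; under eq_bigr do rewrite mulrCA.
  rewrite LsumZ; have /rowP/(_ i) := vG; rewrite !mxE => vGi.
  rewrite (_ : \sum_j _ = 0) ?mulr0// -[RHS]vGi.
  by apply: eq_bigr => j _; rewrite gramE [entry n i * _]mulrC.
apply/rowP => l; rewrite mxE.
have nl : (l <= n)%N by rewrite leq_ord.
have := @coef2_combination n (v 0) (n - l) l; rewrite subnK// leqnn eqxx e0.
by rewrite !coef0 inord_val => <-.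
Qed.

(** This is Gamma_(n+1,k) for the functional [L]; the shift leaves out the empty matrix at index
    0. *)
Definition ttr_coef n k : 'M[R]_(n.+2, n.+1) :=
  gram n.+1 *m (Lmx R n k)^T *m invmx (gram n).

(** The leading monomials cancel in degree n + 1. Nothing occurs in degree n, because all monomials
    of both terms have total degree of the parity of n + 1. *)
Lemma ttr_residue_degree k n j : (1 <= k <= 2)%N -> (j <= n)%N ->
  total_degree_lt n (xvar R k * entry n j - entry n.+1 (j + (k - 1))).
Proof.
move=> hk jn a b nab; rewrite coef2B coef2_xvarM//.
have [nab'|abn] := ltnP n (a + b)%N.
  rewrite [X in _ - X]entry_top; [|lia..].
  case: ifP => h; [rewrite entry_top; [|lia..]|].
    by apply/eqP; rewrite subr_eq0; apply/eqP; congr (_%:R); lia.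
  by rewrite (_ : _ && _ = false) ?subrr//; lia.
have -> : (entry n.+1 (j + (k - 1)))`_a`_b = 0.
  apply/eqP/negPn/negP => /S_parity [|_]; first by clear -jn hk; lia.
  by rewrite (_ : a + b = n)%N /=; [case: odd|lia].
rewrite subr0; case: ifP => // h.
apply/eqP/negPn/negP => /S_parity [//|_].
rewrite (_ : _ + _ = n.-1)%N; last by lia.
by case: n nab jn abn => [|n] /= nab jn abn; [lia|case: odd].
Qed.

Lemma three_term k n j : (1 <= k <= 2)%N -> (j <= n.+1)%N ->
  xvar R k * entry n.+1 j = entry n.+2 (j + (k - 1)) +
    \sum_l (ttr_coef n k (inord j) l)%:P%:P * entry n l.
Proof.
move=> hk jn; apply/eqP; rewrite addrC -subr_eq -subr_eq0; apply/eqP.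
set r := _ - _.
have rn : total_degree_lt n.+1 r.
  apply: total_degree_ltB; first exact: ttr_residue_degree.
  by move=> a b nab; rewrite coef2_combination; [case: eqP => //; lia|lia].
(* As [r] has degree at most n, orthogonality to all polynomials of degree at most n applies to [r]
   itself. *)
apply: L_sqr_eq0.
suff: forall q, total_degree_lt n.+1 q -> L (r * q) = 0 by apply.
apply: span_ind => [|p q hp hq|c p hp|m l mn lm].
- by rewrite mulr0.
- by rewrite mulrDr LD hp hq addr0.
- by rewrite mulrCA LZ hp mulr0.
rewrite /r !mulrBl !LB [X in _ - X - _](_ : _ = 0) ?subr0; last first.
  by apply: S_orth; rewrite gtn_eqF// (leq_trans mn).
rewrite mulr_suml; under eq_bigr do rewrite -mulrA.
rewrite LsumZ -mulrA mulrCA.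
(* For m < n the factor x_k is moved onto [entry m l]; the product has degree at most n and is
   orthogonal to [entry n.+1 j]. *)
have [mltn|] := ltnP m n.
  rewrite orth_low_degree ?sub0r ?big1 ?oppr0// => [i _|].
    by rewrite S_orth ?mulr0// gtn_eqF.
  move=> a b nab; apply: total_degree_lt_xvarM (total_degree_lt_entry lm) _ _ _ => //; lia.
move=> nm; have {mn nm} mE : m = n by lia.
rewrite {m}mE in lm *.
(* For m = n the product x_k S_(n,l) equals S_(n+1,l+k-1) up to lower terms orthogonal to S_(n+1,j),
   which leaves one entry of [gram n.+1]. *)
rewrite -[xvar R k * _](subrK (entry n.+1 (l + (k - 1)))) mulrDr LD.
rewrite orth_low_degree ?add0r; last exact/total_degree_ltS/ttr_residue_degree.
have -> : \sum_i ttr_coef n k (inord j) i * L (entry n i * entry n l) =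
    (ttr_coef n k *m gram n) (inord j) (inord l).
  by rewrite [RHS]mxE; apply: eq_bigr => i _; rewrite gramE inordK.
(* The inverse of [gram n] cancels, and the transpose of [Lmx] selects column l + k - 1 of
   [gram n.+1]. *)
rewrite /ttr_coef mulmxKV ?gram_unit// mxE (bigD1 (inord (l + (k - 1))))//=.
rewrite big1 ?addr0; last first.
  move=> i il; rewrite !mxE inordK// (_ : _ == _ = false) ?mulr0//.
  by apply: contraNF il => /eqP <-; rewrite inord_val.
rewrite gramE !mxE !inordK//; [|lia..].
by rewrite eqxx mulr1 subrr.
Qed.

(** At index 0 the residue has total degree below 0, so all its coefficients vanish. *)
Lemma three_term0 k : (1 <= k <= 2)%N ->
  xvar R k * entry 0 0 = entry 1 (k - 1).
Proof.
move=> hk; apply/eqP; rewrite -subr_eq0; apply/eqP/poly2P => a b.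
by rewrite !coef0; apply: (ttr_residue_degree (j := 0)).
Qed.

(** The coefficient of x^(n-l) y^l in the relation isolates this matrix entry, while in the other
    two terms all powers of y have the parity of j + k - 1. *)
Lemma ttr_coef_parity k n j (l : 'I_n.+1) : (1 <= k <= 2)%N ->
  (j <= n.+1)%N -> odd l != odd (j + (k - 1)) ->
  ttr_coef n k (inord j) l = 0.
Proof.
move=> hk jn odl; have nl : (l <= n)%N by rewrite leq_ord.
have := congr1 (fun p : {poly {poly R}} => p`_(n - l)`_l) (three_term hk jn).
rewrite coef2D coef2_combination ?subnK// eqxx inord_val.
have -> : (entry n.+2 (j + (k - 1)))`_(n - l)`_l = 0.
  apply/eqP; apply: contraNT odl => /S_parity [|->//].
  by case/andP: hk; lia.
rewrite add0r => <-; rewrite coef2_xvarM//; case: ifP => // h.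
apply/eqP; apply: contraNT odl => /S_parity [//|e _].
by rewrite oddD -e oddB ?addbK//; case/andP: h.
Qed.

End ThreeTermRelation.

(** * The substitution of (x^2, y^2) for (x, y) *)

Section SquareSubstitution.
Local Open Scope ring_scope.
Variable R : realType.
Implicit Types p q : {poly {poly R}}.

(** The map over the coefficients, which are polynomials in y, squares y; the outer composition
    squares x. *)
Definition sqvars : {poly {poly R}} -> {poly {poly R}} :=
  comp_poly 'X^2 \o map_poly (comp_poly 'X^2).

HB.instance Definition _ := GRing.RMorphism.on sqvars.

Lemma horner2_sqvars p x y : (sqvars p).[x, y] = p.[x ^+ 2, y ^+ 2].
Proof.
rewrite /sqvars /= horner_comp hornerXn -polyC_exp.
rewrite -[in LHS](comp_polyC (x ^+ 2) 'X^2) horner_map /=.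
by rewrite horner_comp hornerXn.
Qed.

Lemma coef2_sqvars p a b :
  (sqvars p)`_a`_b = if ~~ odd a && ~~ odd b then p`_a./2`_b./2 else 0.
Proof.
rewrite /sqvars /= coef_comp_poly_Xn// dvdn2 divn2.
case: (odd a) => /=; first by rewrite coef0.
by rewrite coef_map /= coef_comp_poly_Xn// dvdn2 divn2.
Qed.

Lemma sqvars_inj : injective sqvars.
Proof.
move=> p q pq; apply: poly2P => a b.
have := congr1 (fun p : {poly {poly R}} => p`_a.*2`_b.*2) pq.
by rewrite !coef2_sqvars !odd_double !doubleK.
Qed.

Lemma sqvarsC (c : R) : sqvars c%:P%:P = c%:P%:P.
Proof. by rewrite /sqvars /= map_polyC /= !comp_polyC. Qed.

Lemma sqvars_xvar k : sqvars (xvar R k) = xvar R k ^+ 2.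
Proof.
rewrite /xvar; case: eqP => _; rewrite /sqvars /=.
  by rewrite map_polyX comp_polyX.
by rewrite map_polyC /= comp_polyX comp_polyC rmorphXn.
Qed.

End SquareSubstitution.

(** * Factorization and parity of the entries of the large system *)

Section SmallSystems.
Local Open Scope ring_scope.
Variables (R : realType) (S : polysystem R) (P : nat -> nat -> polysystem R).
Hypothesis hP : small_systems S P.

(** The pointwise definition becomes an identity of polynomials by [poly2_ext]. The indices are free
    up to equations, so that [lia] can match them. *)
Lemma entry_small i j n (h : 'I_n.+1) N l : (i <= 1)%N -> (j <= 1)%N ->
  N = (n.*2 + i + j)%N -> l = (h.*2 + j)%N ->
  entry S N l = 'X^i * 'Y ^+ j * sqvars (P i j n h ord0).
Proof.
move=> i1 j1 -> ->; apply: poly2_ext => x y.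
by rewrite /entry -hP// !horner2M horner2_sqvars !hornerE.
Qed.

Lemma small_parity n l a b : (l <= n)%N -> (entry S n l)`_a`_b != 0 ->
  odd b = odd l /\ odd (a + b) = odd n.
Proof.
move=> ln; set i : nat := odd (n - l); set j : nat := odd l.
have nE : n = ((l./2 + (n - l)./2).*2 + i + j)%N.
  rewrite doubleD -addnA [(i + j)%N]addnC addnACA [(_ + j)%N]addnC.
  by rewrite [(_ + i)%N]addnC !odd_double_half subnKC.
have hN : (l./2 < (l./2 + (n - l)./2).+1)%N by rewrite ltnS leq_addr.
rewrite (@entry_small i j _ (Ordinal hN)) ?leq_b1 //; last first.
  by rewrite /= addnC odd_double_half.
rewrite -polyC_exp -mulrA (coefXnM i _ a).
case: ltnP => ai; first by rewrite coef0 eqxx.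
rewrite coefCM (coefXnM j _ b); case: ltnP => bj; first by rewrite eqxx.
rewrite coef2_sqvars !oddB// !oddb oddB// oddD.
by case: (odd a); case: (odd b); case: (odd l); case: (odd n); rewrite /= ?eqxx.
Qed.

End SmallSystems.

(** * Selection by the matrices J, and sums over one parity class *)

Section Selection.
Local Open Scope ring_scope.
Variable R : realType.

Lemma select_mx a b c d (J : 'M[R]_(a, b.+1)) (A : 'M[R]_(b.+1, c.+1))
    (K : 'M[R]_(d, c.+1)) h m f g :
  (forall z, J h z = (z == f :> nat)%N%:R) ->
  (forall z, K m z = (z == g :> nat)%N%:R) -> (f <= b)%N -> (g <= c)%N ->
  (J *m A *m K^T) h m = A (inord f) (inord g).
Proof.
move=> JE KE fb gc; rewrite mxE (bigD1 (inord g))//= [X in _ + X]big1 => [|z zg].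
  rewrite addr0 [K^T _ _]mxE KE inordK// eqxx mulr1 mxE.
  rewrite (bigD1 (inord f))//= big1 => [|z zf].
    by rewrite JE inordK// eqxx mul1r addr0.
  rewrite JE (_ : _ == _ = false) ?mul0r//.
  by apply: contraNF zf => /eqP <-; rewrite inord_val.
rewrite [K^T _ _]mxE KE (_ : _ == _ = false) ?mulr0//.
by apply: contraNF zg => /eqP <-; rewrite inord_val.
Qed.

(** For numeral k the column counts are convertible and [conform_mx] is the identity, hence the case
    analysis. *)
Lemma JkE n k h c : (1 <= k <= 2)%N -> Jk R n k h c = (c == h.*2 + (k - 1) :> nat)%N%:R.
Proof.
case: k => [|[|[|k]]]//= _.
  by have -> : Jk R n 1 = Jmx R n 1 0 := conform_mx_id _ _; rewrite mxE.
by have -> : Jk R n 2 = Jmx R n 0 1 := conform_mx_id _ _; rewrite mxE.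
Qed.

Lemma Jk'E n k h c : (1 <= k <= 2)%N -> Jk' R n k h c = (c == h.*2 + (2 - k) :> nat)%N%:R.
Proof.
case: k => [|[|[|k]]]//= _.
  by have -> : Jk' R n 1 = Jmx R n 0 1 := conform_mx_id _ _; rewrite mxE.
by have -> : Jk' R n 2 = Jmx R n 1 0 := conform_mx_id _ _; rewrite mxE.
Qed.

(** The bounds on N say that the indices up to N of parity e are exactly 2m + e with m at most n. *)
Lemma big_parity (V : nmodType) N n (e : bool) (F : 'I_N.+1 -> V) :
  (n.*2 + e <= N < n.*2 + e + 2)%N ->
  (forall l : 'I_N.+1, odd l != e -> F l = 0) ->
  \sum_l F l = \sum_(m < n.+1) F (inord (m.*2 + e)).
Proof.
move=> Nn F0; rewrite (bigID (fun l : 'I_N.+1 => odd l == e)) /=.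
rewrite [X in _ + X]big1 ?addr0 => [|l /F0//].
rewrite (reindex_onto (fun m : 'I_n.+1 => inord (m.*2 + e))
  (fun l : 'I_N.+1 => inord l./2)) /=; last first.
  move=> l /eqP le; apply/val_inj; have := ltn_ord l => lN.
  by rewrite /= inordK inordK; lia.
apply: eq_bigl => m; have mn := ltn_ord m.
rewrite inordK; last by lia.
rewrite (_ : odd _ == _) /=; last by lia.
by apply/eqP/val_inj; rewrite /= inordK; lia.
Qed.

End Selection.

(** * The four relations between small systems *)

Section SmallThreeTerm.
Local Open Scope ring_scope.
Variables (R : realType) (Omega : set (plane R)) (W : plane R -> R).
Variables (S : polysystem R) (P : nat -> nat -> polysystem R) (k : nat).
Hypotheses (hW : weight_function Omega W) (hS : MOPS Omega W S).
Hypotheses (hP : small_systems S P) (hk : (1 <= k <= 2)%N).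

Local Notation G := (Gamma Omega W S).
Local Notation gram := (gram (moment Omega W) S).
Local Notation xk := (xvar R k).
Local Notation entry := (entry S).

Lemma moment_matrixE n m i j :
  moment_matrix Omega W S n m i j = moment Omega W (S n i ord0 * S m j ord0).
Proof.
rewrite mxE /moment; apply: eq_Rintegral => z _.
by rewrite horner2M.
Qed.

Lemma GammaE n : G n.+1 k = ttr_coef (moment Omega W) S n k.
Proof.
have gE m : moment_matrix Omega W S m m = gram m.
  by apply/matrixP => i j; rewrite moment_matrixE mxE.
by rewrite /= !gE.
Qed.

Let hLD := momentD hW.
Let hLZ := momentZ hW.
Let hL0 := moment_sqr_eq0 hW.
Let hmonic := hS.1.
Let hparity := small_parity hP.

Let horth (n m : nat) (i : 'I_n.+1) (j : 'I_m.+1) :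
  n != m -> moment Omega W (S n i ord0 * S m j ord0) = 0.
Proof. by move=> nm; rewrite -moment_matrixE hS.2// mxE. Qed.

(** Common core of the four relations: [D1] is the monomial factor of S_(N+1,J), [D2] that of the
    entries of S_(N+2) and S_N involved, and [e] the parity of the columns kept. After division by
    [D2] the factor [t] remains, which is 1 or x_k in the applications. *)
Lemma small_three_term N J n (e : bool) (D1 D2 t p q : {poly {poly R}})
    (r : 'I_n.+1 -> {poly {poly R}}) :
  (J <= N.+1)%N -> odd (J + (k - 1)) = e -> (n.*2 + e <= N < n.*2 + e + 2)%N ->
  entry N.+1 J = D1 * sqvars p -> entry N.+2 (J + (k - 1)) = D2 * sqvars q ->
  (forall m : 'I_n.+1, entry N (m.*2 + e) = D2 * sqvars (r m)) ->
  D2 != 0 -> xk * D1 = D2 * sqvars t ->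
  t * p = q + \sum_(m < n.+1) (G N.+1 k (inord J) (inord (m.*2 + e)))%:P%:P * r m.
Proof.
move=> JN Je nN Ep Eq Er D20 Dt; rewrite GammaE.
apply: sqvars_inj; apply: (mulfI D20).
rewrite rmorphM mulrA -Dt -mulrA -Ep.
rewrite (three_term hLD hLZ hL0 hmonic horth hparity)//.
rewrite rmorphD mulrDr -Eq; congr (_ + _).
rewrite (big_parity nN) => [|l le].
  rewrite rmorph_sum mulr_sumr; apply: eq_bigr => m _.
  rewrite inordK; last by have := ltn_ord m; lia.
  by rewrite Er rmorphM /= sqvarsC mulrCA.
by rewrite (ttr_coef_parity hLD hLZ hL0 hmonic horth hparity) ?mul0r// Je.
Qed.

Local Notation polymx := (map_mx (fun c : R => c%:P%:P)).
Local Notation Pk := (P (2 - k) (k - 1)).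
Local Notation Pk' := (P (k - 1) (2 - k)).

Let monomial_neq0 i j : 'X^i * 'Y ^+ j != 0 :> {poly {poly R}}.
Proof. by rewrite mulf_neq0// expf_neq0// ?polyC_eq0 polyX_eq0. Qed.

Let xkE : xk = 'X^(2 - k) * 'Y ^+ (k - 1).
Proof.
case: k hk => [|[|[|]]]//= _; rewrite /xvar /=.
  by rewrite mulr1.
by rewrite mul1r.
Qed.

Lemma Lmx_mulE n (v : 'cV[{poly {poly R}}]_n.+2) h :
  (polymx (Lmx R n k) *m v) h ord0 = v (inord (h + (k - 1))) ord0.
Proof.
have hn := ltn_ord h.
rewrite mxE (bigD1 (inord (h + (k - 1))))//= big1 => [|z zh].
  by rewrite !mxE inordK ?eqxx ?mul1r ?addr0//; lia.
rewrite !mxE (_ : _ == _ = false) ?mul0r//.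
by apply: contraNF zh => /eqP <-; rewrite inord_val.
Qed.

(** The column offset k - 1 is written as the boolean [k == 2] so that it can serve as [e] in
    [small_three_term]; [k == 1] stands for 2 - k below. *)
Lemma Gamma00E n h m :
  Gamma00 G k n h m = G n.*2.+2 k (inord h.*2) (inord (m.*2 + (k == 2))).
Proof.
have hn := ltn_ord h; have mn := ltn_ord m.
apply: (@select_mx R n.+2 n.*2.+2 n.*2.+1 n.+1
  (Jmx R n.+1 0 0) (G n.*2.+2 k) (Jk R n k)) => [z|z||]; [| |lia..].
  by rewrite mxE (addn0 h.*2).
by rewrite JkE// (_ : (k == 2 : nat) = k - 1)%N//; lia.
Qed.

Lemma Gamma01E n h m :
  Gamma01 G k n h m = G n.*2.+2 k (inord (h.*2 + 1)) (inord (m.*2 + (k == 1))).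
Proof.
have hn := ltn_ord h; have mn := ltn_ord m.
apply: (@select_mx R n.+1 n.*2.+2 n.*2.+1 n.+1
  (Jmx R n 1 1) (G n.*2.+2 k) (Jk' R n k)) => [z|z||]; [| |lia..].
  by rewrite mxE.
by rewrite Jk'E// (_ : (k == 1 : nat) = 2 - k)%N//; lia.
Qed.

Lemma Gamma11E n h m :
  Gamma11 G k n h m = G n.*2.+3 k (inord (h.*2 + (2 - k))) (inord (m.*2 + true)).
Proof.
have hn := ltn_ord h; have mn := ltn_ord m.
apply: (@select_mx R n.+2 n.*2.+3 n.*2.+2 n.+1
  (Jk' R n.+1 k) (G n.*2.+3 k) (Jmx R n 1 1)) => [z|z||]; [| |lia..].
  by rewrite Jk'E.
by rewrite mxE.
Qed.

Lemma Gamma10E n h m :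
  Gamma10 G k n h m = G n.*2.+1 k (inord (h.*2 + (k - 1))) (inord (m.*2 + false)).
Proof.
have hn := ltn_ord h; have mn := ltn_ord m.
apply: (@select_mx R n.+1 n.*2.+1 n.*2 n.+1
  (Jk R n k) (G n.*2.+1 k) (Jmx R n 0 0)) => [z|z||]; [| |lia..].
  by rewrite JkE.
by rewrite mxE.
Qed.

Lemma small_rel00_0 : P 0%N 0%N 0 = Pk 0.
Proof.
apply/matrixP => h z; rewrite !ord1 {h z}.
apply: sqvars_inj; apply: (mulfI (monomial_neq0 (2 - k) (k - 1))).
rewrite -(@entry_small _ _ _ hP _ _ _ _ 1 (k - 1)) ?double0; [|lia..].
rewrite -xkE -(three_term0 hmonic hparity hk).
by rewrite (@entry_small _ _ _ hP 0 0 0 ord0)// !mul1r.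
Qed.

(** The row S_(2n+2,2h): here [D1] is 1 and [D2] is x_k, so no factor x_k remains. *)
Lemma small_rel00 n :
  P 0%N 0%N n.+1 = Pk n.+1 + polymx (Gamma00 G k n) *m Pk n.
Proof.
apply/matrixP => h z; rewrite !ord1 {z} [RHS]mxE [X in _ + X]mxE -[LHS]mul1r.
have hn := ltn_ord h.
rewrite (@small_three_term n.*2.+1 h.*2 n (k == 2)%N ('X^0 * 'Y ^+ 0)
  ('X^(2 - k) * 'Y ^+ (k - 1)) 1 _ (Pk n.+1 h ord0) (fun m => Pk n m ord0));
  [|lia|lia|lia| | | |exact: monomial_neq0|].
- by congr (_ + _); apply: eq_bigr => m _; rewrite [_ h m]mxE Gamma00E.
- by apply: (entry_small hP); lia.
- by apply: (entry_small hP); lia.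
- by move=> m; apply: (entry_small hP); lia.
- by rewrite xkE rmorph1 !mulr1.
Qed.

Lemma small_rel11_0 : Pk' 0 = P 1%N 1%N 0.
Proof.
apply/matrixP => h z; rewrite !ord1 {h z}.
apply: sqvars_inj; apply: (mulfI (monomial_neq0 1 1)).
rewrite -(@entry_small _ _ _ hP _ _ _ _ 2 1)//.
have -> : 'X^1 * 'Y ^+ 1 = xk * ('X^(k - 1) * 'Y ^+ (2 - k)).
  by rewrite xkE; case: k hk => [|[|[|]]]//= _; ring.
rewrite -mulrA -(@entry_small _ _ _ hP _ _ _ _ 1 (2 - k)) ?double0; [|lia..].
rewrite (three_term hLD hLZ hL0 hmonic horth hparity)//; last lia.
(* The only column has the even index 0, whereas (2 - k) + (k - 1) = 1 is odd. *)
rewrite big_ord1 (ttr_coef_parity hLD hLZ hL0 hmonic horth hparity) //; [|lia|rewrite /=; lia].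
by rewrite mul0r addr0; congr (entry _ _); lia.
Qed.

(** The row S_(2n+3,2h+2-k): [D1] is the other variable and [D2] is xy, so again t = 1. *)
Lemma small_rel11 n :
  Pk' n.+1 = P 1%N 1%N n.+1 + polymx (Gamma11 G k n) *m P 1%N 1%N n.
Proof.
apply/matrixP => h z; rewrite !ord1 {z} [RHS]mxE [X in _ + X]mxE -[LHS]mul1r.
have hn := ltn_ord h.
rewrite (@small_three_term n.*2.+2 (h.*2 + (2 - k)) n true
  ('X^(k - 1) * 'Y ^+ (2 - k)) ('X^1 * 'Y ^+ 1) 1 _ (P 1%N 1%N n.+1 h ord0)
  (fun m => P 1%N 1%N n m ord0));
  [|lia|lia|lia| | | |exact: monomial_neq0|].
- by congr (_ + _); apply: eq_bigr => m _; rewrite [_ h m]mxE Gamma11E.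
- by apply: (entry_small hP); lia.
- by apply: (entry_small hP); lia.
- by move=> m; apply: (entry_small hP); lia.
- by rewrite xkE rmorph1; case: k hk => [|[|[|]]]//= _; ring.
Qed.

(** The row S_(2n+2,2h+1): [D1] is xy and [D2] the other variable, so x_k^2 remains, that is t =
    x_k. *)
Lemma small_rel01 n : xk *: P 1%N 1%N n =
  polymx (Gamma01 G k n) *m Pk' n + polymx (Lmx R n k) *m Pk' n.+1.
Proof.
apply/matrixP => h z; rewrite !ord1 {z} [LHS]mxE [RHS]mxE Lmx_mulE [X in X + _]mxE.
have hn := ltn_ord h.
rewrite addrC (@small_three_term n.*2.+1 (h.*2 + 1) n (k == 1)%N
  ('X^1 * 'Y ^+ 1) ('X^(k - 1) * 'Y ^+ (2 - k)) xk _
  (Pk' n.+1 (inord (h + (k - 1))) ord0) (fun m => Pk' n m ord0));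
  [|lia|lia|lia| | | |exact: monomial_neq0|].
- by congr (_ + _); apply: eq_bigr => m _; rewrite [_ h m]mxE Gamma01E.
- by apply: (entry_small hP); lia.
- by apply: (entry_small hP); rewrite ?inordK //; lia.
- by move=> m; apply: (entry_small hP); lia.
- by rewrite sqvars_xvar xkE; case: k hk => [|[|[|]]]//= _; ring.
Qed.

(** The row S_(2n+1,2h+k-1): [D1] is x_k and [D2] is 1, so t = x_k. *)
Lemma small_rel10 n : xk *: Pk n =
  polymx (Gamma10 G k n) *m P 0%N 0%N n + polymx (Lmx R n k) *m P 0%N 0%N n.+1.
Proof.
apply/matrixP => h z; rewrite !ord1 {z} [LHS]mxE [RHS]mxE Lmx_mulE [X in X + _]mxE.
have hn := ltn_ord h.
rewrite addrC (@small_three_term n.*2 (h.*2 + (k - 1)) n false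
  ('X^(2 - k) * 'Y ^+ (k - 1)) ('X^0 * 'Y ^+ 0) xk _
  (P 0%N 0%N n.+1 (inord (h + (k - 1))) ord0) (fun m => P 0%N 0%N n m ord0));
  [|lia|lia|lia| | | |exact: monomial_neq0|].
- by congr (_ + _); apply: eq_bigr => m _; rewrite [_ h m]mxE Gamma10E.
- by apply: (entry_small hP); lia.
- by apply: (entry_small hP); rewrite ?inordK //; lia.
- by move=> m; apply: (entry_small hP); lia.
- by rewrite sqvars_xvar xkE; case: k hk => [|[|[|]]]//= _; ring.
Qed.

End SmallThreeTerm.

(** * Semi-infinite block matrices with finitely supported rows *)

Section BlockAlgebra.
Local Open Scope classical_set_scope.
Local Open Scope ring_scope.
Variable R : realType.
Implicit Types (A B : blockmx R) (v : polysystem R).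

Local Notation polymx := (map_mx (fun c : R => c%:P%:P)).

Lemma fsum_nat (V : nmodType) (F : nat -> V) N :
  (forall n, (N <= n)%N -> F n = 0) ->
  \sum_(n \in [set: nat]) F n = \sum_(n < N) F n.
Proof.
move=> F0; rewrite (fsbig_ord _ _ F).
apply/esym/fsbig_widen => // n [_] /= /negP; rewrite -leqNgt.
exact: F0.
Qed.

(** Both bidiagonal shapes satisfy this bound, which turns the sums over all columns into finite
    ones. *)
Definition banded A := forall m n, (m.+1 < n)%N -> A m n = 0.

(* [polyC \o polyC] is the coefficient map of [polymx], written so that its
   ring morphism structure is found. *)
Lemma bmulvE A v m N : banded A -> (m.+2 <= N)%N ->
  bmulv A v m = \sum_(n < N) polymx (A m n) *m v n.
Proof.
move=> bA mN; apply: fsum_nat => n Nn.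
by rewrite bA ?(map_mx0 (polyC \o polyC)) ?mul0mx// (leq_trans mN).
Qed.

Lemma bmulE A B m p : banded A ->
  bmul A B m p = \sum_(n < m.+2) A m n *m B n p.
Proof. by move=> bA; apply: fsum_nat => n mn; rewrite bA ?mul0mx. Qed.

(** Associativity is an exchange of finite sums. Row m of [A] ends at column m + 1, but row m of the
    product only at m + 2, hence the truncations [m.+2] and [m.+3]. *)
Lemma bmulv_bmul A B v : banded A -> banded B ->
  bmulv (bmul A B) v = bmulv A (bmulv B v).
Proof.
move=> bA bB; apply: functional_extensionality_dep => m.
rewrite (@bmulvE A _ m m.+2)// [LHS](@fsum_nat _ _ m.+3) => [|p mp]; last first.
  rewrite bmulE// big1 ?(map_mx0 (polyC \o polyC)) ?mul0mx// => n _.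
  by rewrite bB ?mulmx0// (leq_trans _ mp)// ltnS.
under eq_bigr do rewrite bmulE// (map_mx_sum (polyC \o polyC)) mulmx_suml.
rewrite exchange_big /=; apply: eq_bigr => n _.
rewrite (@bmulvE B v n m.+3)//; last by rewrite !ltnS -ltnS.
rewrite mulmx_sumr.
by apply: eq_bigr => p _; rewrite (map_mxM (polyC \o polyC)) mulmxA.
Qed.

Lemma bmulv_scale A c v : banded A -> bmulv A (bscale c v) = bscale c (bmulv A v).
Proof.
move=> bA; apply: functional_extensionality_dep => m.
rewrite /bscale !(@bmulvE _ _ m m.+2)// scaler_sumr.
by apply: eq_bigr => n _; rewrite scalemxAr.
Qed.

Lemma banded_lower D : banded (@block_lower R D).
Proof. by move=> m n mn; rewrite /block_lower !ltn_eqF// ltnW // ltnW. Qed.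

Lemma banded_upper D E : banded (@block_upper R D E).
Proof. by move=> m n mn; rewrite /block_upper !gtn_eqF// ltnW. Qed.

Lemma bmulv_lower0 D v : bmulv (@block_lower R D) v 0%N = v 0%N.
Proof.
rewrite (@bmulvE _ _ _ 2)//; last exact: banded_lower.
rewrite !big_ord_recr big_ord0 /= /block_lower /= conform_mx_id.
by rewrite (map_mx0 (polyC \o polyC)) mul0mx addr0 add0r (map_mx1 (polyC \o polyC)) mul1mx.
Qed.

Lemma bmulv_lowerS D v m : bmulv (@block_lower R D) v m.+1 =
  v m.+1 + polymx (D m) *m v m.
Proof.
rewrite (@bmulvE _ _ _ m.+3)//; last exact: banded_lower.
rewrite !big_ord_recr /= big1 => [|n _].
  rewrite /block_lower !eqxx (gtn_eqF (ltnSn m)) !conform_mx_id !ltn_eqF//.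
  rewrite (map_mx0 (polyC \o polyC)) mul0mx addr0 add0r addrC.
  by rewrite (map_mx1 (polyC \o polyC)) mul1mx.
have nm := ltn_ord n.
by rewrite /block_lower eqSS !gtn_eqF ?(map_mx0 (polyC \o polyC)) ?mul0mx// ltnW.
Qed.

Lemma bmulv_upper D E v m : bmulv (@block_upper R D E) v m =
  polymx (D m) *m v m + polymx (E m) *m v m.+1.
Proof.
rewrite (@bmulvE _ _ _ m.+2)//; last exact: banded_upper.
rewrite !big_ord_recr /= big1 => [|n _].
  by rewrite /block_upper !eqxx gtn_eqF// !conform_mx_id add0r.
have nm := ltn_ord n.
by rewrite /block_upper !ltn_eqF ?(map_mx0 (polyC \o polyC)) ?mul0mx// ltnW.
Qed.

End BlockAlgebra.

Theorem mainTheorem5 (R : realType) (Omega : set (plane R)) (W : plane R -> R)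
    (S : polysystem R) (P : nat -> nat -> polysystem R) (k : nat)
    (hW : weight_function Omega W) (hsym : xy_symmetric Omega W)
    (hS : MOPS Omega W S) (hP : small_systems S P)
    (hk : 1 <= k <= 2) :
  let G := Gamma Omega W S in
  let xk := xvar R k in
  (bscale xk (P 0 0) = bscale xk (bmulv (L0 G k) (P (2 - k) (k - 1))) /\
   bscale xk (P 0 0) = bmulv (bmul (L0 G k) (U1 G k)) (P 0 0)) /\
  (bscale xk (P 1 1) = bmulv (U0 G k) (P (k - 1) (2 - k)) /\
   bscale xk (P 1 1) = bmulv (bmul (U0 G k) (L1 G k)) (P 1 1)) /\
  (bscale xk (P (2 - k) (k - 1)) = bmulv (U1 G k) (P 0 0) /\
   bscale xk (P (2 - k) (k - 1))
     = bmulv (bmul (U1 G k) (L0 G k)) (P (2 - k) (k - 1))) /\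
  (bscale xk (P (k - 1) (2 - k))
     = bscale xk (bmulv (L1 G k) (P 1 1)) /\
   bscale xk (P (k - 1) (2 - k))
     = bmulv (bmul (L1 G k) (U0 G k)) (P (k - 1) (2 - k))).
Proof.
move=> G xk.
(* The identities without matrix products come first, block row by block row; block row 0 of a lower
   matrix is a case of its own. *)
have P00E : P 0 0 = bmulv (L0 G k) (P (2 - k) (k - 1)).
  apply: functional_extensionality_dep => -[|n].
    by rewrite /L0 bmulv_lower0 (small_rel00_0 hS hP hk).
  by rewrite /L0 bmulv_lowerS (small_rel00 hW hS hP hk).
have Pk'E : P (k - 1) (2 - k) = bmulv (L1 G k) (P 1 1).
  apply: functional_extensionality_dep => -[|n].
    by rewrite /L1 bmulv_lower0 (small_rel11_0 hW hS hP hk).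
  by rewrite /L1 bmulv_lowerS (small_rel11 hW hS hP hk).
have P11E : bscale xk (P 1 1) = bmulv (U0 G k) (P (k - 1) (2 - k)).
  apply: functional_extensionality_dep => n.
  by rewrite /U0 bmulv_upper -(small_rel01 hW hS hP hk).
have PkE : bscale xk (P (2 - k) (k - 1)) = bmulv (U1 G k) (P 0 0).
  apply: functional_extensionality_dep => n.
  by rewrite /U1 bmulv_upper -(small_rel10 hW hS hP hk).
have bL0 : banded (L0 G k) := banded_lower _.
have bL1 : banded (L1 G k) := banded_lower _.
have bU0 : banded (U0 G k) := banded_upper _ _.
have bU1 : banded (U1 G k) := banded_upper _ _.
(* In each product the inner factor collapses by one of these identities, and x_k commutes with the
   outer matrix. *)
rewrite !bmulv_bmul// -PkE -P11E -P00E -Pk'E !bmulv_scale//.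
by rewrite -P00E -Pk'E.
Qed.
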